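(* Let $*$ be a continuous t-norm on the unit interval $[0,1]$. The category $[0,1]_*\text{-}\mathbf{Set}$ of $[0,1]_*$-sets and their morphisms is cartesian closed if, and only if, $*$ is the minimum t-norm on $[0,1]$, i.e. $p*q=\min\{p,q\}$ for all $p,q\in[0,1]$.
   Context: A continuous t-norm on $[0,1]$ is a binary operation $*$ on $[0,1]$ such that $([0,1],*,1)$ is a commutative monoid, $*$ is monotone in each variable ($p*q\leq p'*q'$ whenever $p\leq p'$ and $q\leq q'$), and $*\colon[0,1]\times[0,1]\to[0,1]$ is continuous in the usual topology. Its implication $\to$ is determined by $p*q\leq r\iff q\leq p\to r$ for all $p,q,r\in[0,1]$. The symbols $\wedge$, $\vee$, $\bigvee$ denote meets, joins and suprema in $[0,1]$ (the empty supremum is $0$). A $[0,1]_*$-set is a pair $(X,\alpha)$ of a set $X$ and a map $\alpha\colon X\times X\to[0,1]$ such that for all $x,y,z\in X$: (S1) $\alpha(x,y)\leq\alpha(x,x)\wedge\alpha(y,y)$; (S2) $\alpha(x,y)=\alpha(y,x)$; (S3) $\alpha(y,z)*(\alpha(y,y)\to\alpha(x,y))\leq\alpha(x,z)$. A morphism $\phi\colon(X,\alpha)\rightsquigarrow(Y,\beta)$ of $[0,1]_*$-sets is a function $\phi\colon X\times Y\to[0,1]$ such that for all $x,x'\in X$, $y,y'\in Y$: (M1) $\phi(x,y)\leq\alpha(x,x)\wedge\beta(y,y)$; (M2) $(\beta(y,y)\to\beta(y,y'))*\phi(x,y)*(\alpha(x,x)\to\alpha(x',x))\leq\phi(x',y')$;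 (M3) $\phi(x,y')*(\alpha(x,x)\to\phi(x,y))\leq\beta(y,y')$; (M4) $\alpha(x,x')\leq\bigvee_{y\in Y}\phi(x',y)*(\beta(y,y)\to\phi(x,y))$. The composite of $\phi\colon(X,\alpha)\rightsquigarrow(Y,\beta)$ and $\psi\colon(Y,\beta)\rightsquigarrow(Z,\gamma)$ is $(\psi\circ\phi)(x,z)=\bigvee_{y\in Y}\psi(y,z)*(\beta(y,y)\to\phi(x,y))$, and the identity morphism on $(X,\alpha)$ is $\alpha$ itself. These data form the category $[0,1]_*\text{-}\mathbf{Set}$. A category with finite products is cartesian closed if, for every object $Y$, the functor $-\times Y$ admits a right adjoint. *)

(* Defs.v *)
From HB Require Import structures.
From mathcomp Require Import all_boot all_order all_algebra.
From mathcomp Require Import interval_inference.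
From mathcomp Require Import all_classical all_reals all_analysis.

Set Implicit Arguments.
Unset Strict Implicit.
Unset Printing Implicit Defensive.

Import Order.TTheory GRing.Theory Num.Theory.
Import numFieldNormedType.Exports.

Local Open Scope classical_set_scope.
Local Open Scope ring_scope.

Record category : Type := Category {
  obj :> Type;
  hom : obj -> obj -> Type;
  idm : forall X, hom X X;
  comp : forall X Y Z, hom Y Z -> hom X Y -> hom X Z;
  compA : forall X Y Z W (h : hom Z W) (g : hom Y Z) (f : hom X Y),
    comp h (comp g f) = comp (comp h g) f;
  comp1m : forall X Y (f : hom X Y), comp (idm Y) f = f;
  compm1 : forall X Y (f : hom X Y), comp f (idm X) = f }.

Arguments hom {c} _ _.
Arguments idm {c} _.
Arguments comp {c X Y Z} _ _.

Record functor (C D : category) : Type := Functor {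
  fobj :> C -> D;
  fmap : forall X Y, hom X Y -> hom (fobj X) (fobj Y);
  fmap1 : forall X, fmap (idm X) = idm (fobj X);
  fmapM : forall X Y Z (g : hom Y Z) (f : hom X Y),
    fmap (comp g f) = comp (fmap g) (fmap f) }.

Arguments fmap {C D} _ {X Y} _.

Record adjunction (C D : category) (F : functor C D) (G : functor D C) : Type :=
  Adjunction {
  adj : forall X Z, hom (F X) Z -> hom X (G Z);
  adj_bij : forall X Z, bijective (@adj X Z);
  adj_natl : forall X X' Z (f : hom X' X) (h : hom (F X) Z),
    adj (comp h (fmap F f)) = comp (adj h) f;
  adj_natr : forall X Z Z' (k : hom Z Z') (h : hom (F X) Z),
    adj (comp k h) = comp (fmap G k) (adj h) }.

Definition has_right_adjoint (C D : category) (F : functor C D) : Prop :=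
  exists G : functor D C, inhabited (adjunction F G).

(* A terminal object together with binary products: these generate all finite
   products. *)
Record finite_products (C : category) : Type := FiniteProducts {
  terminal : C;
  bang : forall X, hom X terminal;
  bang_uniq : forall X (f : hom X terminal), f = bang X;
  prd : C -> C -> C;
  prj1 : forall X Y, hom (prd X Y) X;
  prj2 : forall X Y, hom (prd X Y) Y;
  pairing : forall X Y Z, hom Z X -> hom Z Y -> hom Z (prd X Y);
  prj1_pairing : forall X Y Z (f : hom Z X) (g : hom Z Y),
    comp (prj1 X Y) (pairing f g) = f;
  prj2_pairing : forall X Y Z (f : hom Z X) (g : hom Z Y),
    comp (prj2 X Y) (pairing f g) = g;
  pairing_uniq : forall X Y Z (h : hom Z (prd X Y)),
    h = pairing (comp (prj1 X Y) h) (comp (prj2 X Y) h) }.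

Arguments prj1 {C} _ _ _.
Arguments prj2 {C} _ _ _.
Arguments pairing {C} _ {X Y Z} _ _.
Arguments pairing_uniq {C} _ {X Y Z} _.

Section ProductFunctor.
Variables (C : category) (P : finite_products C) (Y : C).

Definition prd_map (X X' : C) (f : hom X X') : hom (prd P X Y) (prd P X' Y) :=
  pairing P (comp f (prj1 P X Y)) (prj2 P X Y).

Lemma prd_map1 (X : C) : prd_map (idm X) = idm (prd P X Y).
Proof. by rewrite [RHS](pairing_uniq P) /prd_map comp1m !compm1. Qed.

Lemma prd_mapM (X X' X'' : C) (g : hom X' X'') (f : hom X X') :
  prd_map (comp g f) = comp (prd_map g) (prd_map f).
Proof.
rewrite [RHS](pairing_uniq P) /prd_map !compA.
by rewrite prj1_pairing prj2_pairing -!compA prj1_pairing prj2_pairing.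
Qed.

Definition prd_functor : functor C C := Functor prd_map1 prd_mapM.

End ProductFunctor.

Definition cartesian_closed (C : category) : Prop :=
  exists P : finite_products C, forall Y : C, has_right_adjoint (prd_functor P Y).

(* {i01 R} carries no library topology; its usual one is induced from R. *)
Definition i01_val (R : realType) (p : {i01 R}) : R := p%:num.

HB.instance Definition _ (R : realType) :=
  Topological.copy {i01 R} (initial_topology (@i01_val R)).

Record continuous_tnorm (R : realType) : Type := ContinuousTNorm {
  tn :> {i01 R} -> {i01 R} -> {i01 R};
  tnA : associative tn;
  tnC : commutative tn;
  tn1p : left_id 1%:i01 tn;
  tn_le : forall p p' q q' : {i01 R}, p <= p' -> q <= q' -> tn p q <= tn p' q';
  tn_continuous : continuous (fun pq : {i01 R} * {i01 R} => tn pq.1 pq.2) }.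

Section Quantale.
Variables (R : realType) (T : continuous_tnorm R).
Local Notation I := {i01 R}.
Implicit Types p q r : I.

(* The residual p -> r is the largest q with p * q <= r; see tn_impP. *)
Definition tn_imp p r : I := supremum 0%:i01 [set q | T p q <= r].
Definition bigvee (J : Type) (f : J -> I) : I := supremum 0%:i01 (range f).

Lemma i01_le p q : (p <= q) = (p%:num <= q%:num). Proof. by []. Qed.
Lemma i01_ge0 p : 0%:i01 <= p. Proof. by rewrite i01_le /=. Qed.
Lemma i01_le1 p : p <= 1%:i01. Proof. by rewrite i01_le /=. Qed.

Lemma i01_supremums (A : set I) : A !=set0 -> supremums A !=set0.
Proof.
move=> [a Aa]; set B := [set x : R | exists2 p, A p & p%:num = x].
have B1 : ubound B 1 by move=> _ [p _ <-].
have hB : has_ubound B by exists 1.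
have s0 : 0 <= sup B.
  by apply: (@le_trans _ _ a%:num) => //; apply: ub_le_sup => //; exists a.
have s1 : sup B <= 1 by apply: ge_sup => //; exists a%:num; exists a.
exists (Itv01 s0 s1); split=> [p Ap|q uq]; rewrite i01_le /=.
  by apply: ub_le_sup => //; exists p.
apply: ge_sup; first by exists a%:num; exists a.
by move=> _ [p Ap <-]; rewrite -i01_le; apply: uq.
Qed.

Lemma i01_sup_ub (A : set I) p : A p -> p <= supremum 0%:i01 A.
Proof. by move=> Ap; apply: ge_supremum_Nmem => //; apply: i01_supremums; exists p. Qed.

Lemma i01_sup_le (A : set I) q :
  (forall p, A p -> p <= q) -> supremum 0%:i01 A <= q.
Proof.
move=> Aq; rewrite /supremum; case: ifPn => [_|/set0P/i01_supremums[s ss]].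
  exact: i01_ge0.
by case: xgetP => [x -> [_ lx]|/(_ s)//]; exact: lx.
Qed.

Lemma i01_clip_ge0 (x : R) : 0 <= Num.max 0 (Num.min 1 x).
Proof. by rewrite le_max lexx. Qed.
Lemma i01_clip_le1 (x : R) : Num.max 0 (Num.min 1 x) <= 1.
Proof. by rewrite ge_max ler01 ge_min lexx. Qed.
Definition i01_clip (x : R) : I := Itv01 (i01_clip_ge0 x) (i01_clip_le1 x).

Lemma i01_clipK p : i01_clip p%:num = p.
Proof.
apply: val_inj => /=; have := i01_ge0 p; have := i01_le1 p; rewrite !i01_le /=.
by move=> p1 p0; rewrite (min_idPr p1) (max_idPr p0).
Qed.

Lemma i01_clip_continuous : continuous i01_clip.
Proof.
pose f (x : R) : R^o := Num.max 0 (Num.min 1 x).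
have fc : continuous f.
  move=> x; apply: (@continuous_max R R (cst 0) (cst 1 \min id)).
    exact: cvg_cst.
  by apply: (@continuous_min R R (cst 1) id); [exact: cvg_cst|exact: cvg_id].
exact: (@continuous_comp_initial _ _ _ (@i01_val R) i01_clip fc).
Qed.

Lemma tn_i01_val_continuous p :
  continuous (fun x : R => (T p (i01_clip x))%:num).
Proof.
move=> x; apply: (@continuous_comp _ _ _ (fun x => T p (i01_clip x)) (@i01_val R)).
  apply: (@continuous_comp _ _ _ (fun x => (p, i01_clip x)) (fun pq => T pq.1 pq.2)).
    exact: (@cvg_pair _ _ _ (nbhs x) (nbhs p) (nbhs (i01_clip x)) _
      (nbhs_filter p) (nbhs_filter _) _ _ (cvg_cst p) (@i01_clip_continuous x)).
  exact: tn_continuous.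
exact: initial_continuous.
Qed.

Lemma tnp1 p : T p 1%:i01 = p. Proof. by rewrite tnC tn1p. Qed.
Lemma tn_ler p q : T p q <= p.
Proof. by rewrite -[leRHS]tnp1 tn_le // i01_le1. Qed.
Lemma tn_lel p q : T p q <= q.
Proof. by rewrite tnC tn_ler. Qed.

Lemma tn_ivt p q r : r <= T p q -> exists2 s, s <= q & T p s = r.
Proof.
move=> rpq; pose f (x : R) := (T p (i01_clip x))%:num.
have f0 : f 0 = 0.
  apply/eqP; rewrite eq_le; have := i01_ge0 (T p (i01_clip 0)).
  rewrite i01_le /f /= => ->; rewrite andbT.
  have := tn_lel p (i01_clip 0); rewrite i01_le /= => /le_trans; apply.
  by rewrite ge_max lexx ge_min lexx orbT.
have fq : f q%:num = (T p q)%:num by rewrite /f i01_clipK.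
have [|||x] := @IVT R f 0 q%:num r%:num.
- by have := i01_ge0 q; rewrite i01_le.
- by apply: continuous_subspaceT; exact: tn_i01_val_continuous.
- have r0 : 0 <= r%:num :> R by have := i01_ge0 r; rewrite i01_le.
  have pq0 : 0 <= (T p q)%:num :> R by have := i01_ge0 (T p q); rewrite i01_le.
  by rewrite f0 fq (min_idPl pq0) (max_idPr pq0) r0.
rewrite in_itv /= => /andP[x0 xq] fx; exists (i01_clip x).
  rewrite i01_le /= ge_max ge_min xq orbT andbT.
  by have := i01_ge0 q; rewrite i01_le.
exact: val_inj.
Qed.

Lemma tn_impP p q r : (T p q <= r) = (q <= tn_imp p r).
Proof.
apply/idP/idP => [|qpr]; first exact: i01_sup_ub.
apply: (le_trans (tn_le T (lexx p) qpr)).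
rewrite leNgt; apply/negP => rs.
have [m rm ms] : exists2 m : I, r < m & m < T p (tn_imp p r).
  pose s := T p (tn_imp p r).
  have m0 : 0 <= (r%:num + s%:num) / 2 :> R by [].
  have rs' : r%:num < s%:num :> R by [].
  have m1 : (r%:num + s%:num) / 2 <= 1 :> R.
    have := i01_le1 s; rewrite i01_le /= => s1.
    by rewrite ler_pdivrMr // mul1r [2]mulr2n lerD // (le_trans (ltW rs')).
  by exists (Itv01 m0 m1); [have := midf_lt rs' => -[]..].
have [s sle Tps] := tn_ivt (ltW ms).
have [q' /= q'r] : exists2 q', T p q' <= r & s < q'.
  apply: contrapT => no.
  have : tn_imp p r <= s.
    apply: i01_sup_le => q' /= q'r; rewrite leNgt; apply/negP => sq'.
    by apply: no; exists q'.
  by move=> les; move: ms; rewrite ltNge -Tps tn_le.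
move=> /ltW sq'.
by move: (tn_le T (lexx p) sq'); rewrite Tps leNgt (le_lt_trans q'r rm).
Qed.

Lemma tn_impK p q : T p (tn_imp p q) <= q.
Proof. by rewrite tn_impP. Qed.

Lemma tn_imppp p : tn_imp p p = 1%:i01.
Proof. by apply/eqP; rewrite eq_le i01_le1 -tn_impP tnp1 lexx. Qed.

Lemma tn_div p b : p <= b -> T b (tn_imp b p) = p.
Proof.
move=> pb; apply/eqP; rewrite eq_le tn_impK /=.
have [|s _ <-] := @tn_ivt b 1%:i01 p; first by rewrite tnp1.
by rewrite tn_le // -tn_impP.
Qed.

Lemma tnCA p q r : T p (T q r) = T q (T p r).
Proof. by rewrite !tnA (tnC T p q). Qed.
Lemma tnAC p q r : T (T p q) r = T (T p r) q.
Proof. by rewrite -!tnA (tnC T q r). Qed.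

Lemma tn_swap p q b : p <= b -> q <= b -> T q (tn_imp b p) = T p (tn_imp b q).
Proof.
by move=> pb qb; rewrite -{1}(tn_div qb) -{2}(tn_div pb) tnAC.
Qed.

Lemma bigvee_ub (J : Type) (f : J -> I) j : f j <= bigvee f.
Proof. by apply: i01_sup_ub; exists j. Qed.

Lemma bigvee_le (J : Type) (f : J -> I) q :
  (forall j, f j <= q) -> bigvee f <= q.
Proof. by move=> fq; apply: i01_sup_le => _ [j _ <-]. Qed.

Lemma tn_bigvee (J : Type) (f : J -> I) p :
  T p (bigvee f) = bigvee (fun j => T p (f j)).
Proof.
apply/eqP; rewrite eq_le; apply/andP; split.
  rewrite tn_impP; apply: bigvee_le => j; rewrite -tn_impP.
  exact: (@bigvee_ub _ (fun j => T p (f j))).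
by apply: bigvee_le => j; rewrite tn_le // bigvee_ub.
Qed.

Lemma bigvee_tn (J : Type) (f : J -> I) p :
  T (bigvee f) p = bigvee (fun j => T (f j) p).
Proof. by rewrite tnC tn_bigvee; congr bigvee; apply/funext => j; rewrite tnC. Qed.

Lemma bigvee_exchange (J K : Type) (f : J -> K -> I) :
  bigvee (fun j => bigvee (f j)) = bigvee (fun k => bigvee (f^~ k)).
Proof.
apply/eqP; rewrite eq_le; apply/andP; split; apply: bigvee_le => j;
  apply: bigvee_le => k.
  by apply: le_trans (bigvee_ub _ k); exact: (bigvee_ub (f^~ k)).
by apply: le_trans (bigvee_ub _ k); exact: (bigvee_ub (f k)).
Qed.

End Quantale.

Section TSet.
Variables (R : realType) (T : continuous_tnorm R).
Local Notation I := {i01 R}.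
Local Notation "p '**' q" := (T p q) (at level 40, left associativity).
Local Notation "p '~>' q" := (tn_imp T p q) (at level 55, right associativity).

Record tset : Type := TSet {
  car :> Type;
  teq : car -> car -> I;
  tset_S1 : forall x y, teq x y <= Num.min (teq x x) (teq y y);
  tset_S2 : forall x y, teq x y = teq y x;
  tset_S3 : forall x y z, teq y z ** (teq y y ~> teq x y) <= teq x z }.

Record thom (X Y : tset) : Type := THom {
  tfun :> X -> Y -> I;
  thom_M1 : forall x y, tfun x y <= Num.min (teq x x) (teq y y);
  thom_M2 : forall x x' y y',
    (teq y y ~> teq y y') ** tfun x y ** (teq x x ~> teq x' x) <= tfun x' y';
  thom_M3 : forall x y y',
    tfun x y' ** (teq x x ~> tfun x y) <= teq y y';
  thom_M4 : forall x x',
    teq x x' <= bigvee (fun y => tfun x' y ** (teq y y ~> tfun x y)) }.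

Lemma thom_ext (X Y : tset) (f g : thom X Y) :
  (forall x y, f x y = g x y) -> f = g.
Proof.
case: f => f f1 f2 f3 f4; case: g => g g1 g2 g3 g4 /= fg.
have {}fg : f = g by apply/funext => x; apply/funext => y.
by subst g; congr THom; exact: Prop_irrelevance.
Qed.

Lemma teq_lel (X : tset) (x y : X) : teq x y <= teq x x.
Proof. by have := tset_S1 x y; rewrite le_min => /andP[]. Qed.
Lemma teq_ler (X : tset) (x y : X) : teq x y <= teq y y.
Proof. by have := tset_S1 x y; rewrite le_min => /andP[]. Qed.
Lemma thom_lel (X Y : tset) (f : thom X Y) x y : f x y <= teq x x.
Proof. by have := thom_M1 f x y; rewrite le_min => /andP[]. Qed.
Lemma thom_ler (X Y : tset) (f : thom X Y) x y : f x y <= teq y y.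
Proof. by have := thom_M1 f x y; rewrite le_min => /andP[]. Qed.

Lemma thom_M2l (X Y : tset) (f : thom X Y) x x' y :
  f x y ** (teq x x ~> teq x' x) <= f x' y.
Proof. by have := thom_M2 f x x' y y; rewrite tn_imppp tn1p. Qed.

Lemma thom_M2r (X Y : tset) (f : thom X Y) x y y' :
  (teq y y ~> teq y y') ** f x y <= f x y'.
Proof. by have := thom_M2 f x x y y'; rewrite tn_imppp tnp1. Qed.

Section Identity.
Variable X : tset.

Lemma tid_M2 (x x' y y' : X) :
  (teq y y ~> teq y y') ** teq x y ** (teq x x ~> teq x' x) <= teq x' y'.
Proof.
apply: le_trans (tset_S3 x' x y'); rewrite tn_le // tnC.
by rewrite (tset_S2 x y) (tset_S2 x y') (tset_S2 y y') tset_S3.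
Qed.

Lemma tid_M3 (x y y' : X) : teq x y' ** (teq x x ~> teq x y) <= teq y y'.
Proof. by rewrite (tset_S2 x y) tset_S3. Qed.

Lemma tid_M4 (x x' : X) :
  teq x x' <= bigvee (fun y => teq x' y ** (teq y y ~> teq x y)).
Proof.
apply: le_trans (bigvee_ub _ x).
by rewrite tn_imppp tnp1 tset_S2.
Qed.

Definition tid : thom X X := THom (@tset_S1 X) tid_M2 tid_M3 tid_M4.

End Identity.

Section Composition.
Variables (X Y Z : tset) (g : thom Y Z) (f : thom X Y).

Definition tcomp_fun (x : X) (z : Z) : I :=
  bigvee (fun y => g y z ** (teq y y ~> f x y)).

Lemma tcomp_funE (x : X) (z : Z) :
  tcomp_fun x z = bigvee (fun y => f x y ** (teq y y ~> g y z)).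
Proof.
congr bigvee; apply/funext => y.
by apply: tn_swap; [exact: thom_ler|exact: thom_lel].
Qed.

Lemma tcomp_M1 x z : tcomp_fun x z <= Num.min (teq x x) (teq z z).
Proof.
rewrite le_min; apply/andP; split.
  rewrite tcomp_funE; apply: bigvee_le => y.
  exact: le_trans (tn_ler _ _ _) (thom_lel _ _ _).
by apply: bigvee_le => y; exact: le_trans (tn_ler _ _ _) (thom_ler _ _ _).
Qed.

Lemma tcomp_M2 x x' z z' :
  (teq z z ~> teq z z') ** tcomp_fun x z ** (teq x x ~> teq x' x)
    <= tcomp_fun x' z'.
Proof.
rewrite tn_bigvee bigvee_tn; apply: bigvee_le => y.
apply: le_trans (bigvee_ub _ y).
rewrite tnA -tnA tn_le //; first exact: thom_M2r.
rewrite -tn_impP tnA.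
by apply: le_trans (thom_M2l f x x' y); rewrite tn_le // tn_impK.
Qed.

Lemma tcomp_M3 x z z' :
  tcomp_fun x z' ** (teq x x ~> tcomp_fun x z) <= teq z z'.
Proof.
rewrite tcomp_funE bigvee_tn; apply: bigvee_le => y'.
have Cx : tcomp_fun x z <= teq x x.
  by have := tcomp_M1 x z; rewrite le_min => /andP[].
rewrite tnAC (tn_swap T Cx (thom_lel f x y')).
rewrite tcomp_funE !bigvee_tn; apply: bigvee_le => y.
rewrite (tnAC T (f x y)).
apply: le_trans (thom_M3 g y z z').
have fy : f x y ** (teq x x ~> f x y') <= teq y' y := thom_M3 f x y' y.
apply: (@le_trans _ _ (teq y' y ** (teq y y ~> g y z) ** (teq y' y' ~> g y' z'))).
  by rewrite !tn_le.
rewrite tnAC tn_le //.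
rewrite -(tn_swap T _ (thom_lel g y' z')) ?teq_lel //.
by rewrite (tset_S2 y' y) thom_M2l.
Qed.

Lemma tcomp_M4 x x' :
  teq x x' <= bigvee (fun z => tcomp_fun x' z ** (teq z z ~> tcomp_fun x z)).
Proof.
apply: le_trans (thom_M4 f x x') _; apply: bigvee_le => y.
rewrite -{1}(tn_div T (thom_ler f x' y)) -tnA tnC.
apply: (@le_trans _ _ (bigvee (fun z => g y z ** (teq z z ~> g y z))
    ** ((teq y y ~> f x' y) ** (teq y y ~> f x y)))).
  by rewrite tnC tn_le // thom_M4.
rewrite bigvee_tn; apply: bigvee_le => z.
apply: le_trans (bigvee_ub _ z).
rewrite tnA (tnAC T (g y z)) -tnA tn_le //.
  exact: (bigvee_ub (fun y => g y z ** (teq y y ~> f x' y))).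
rewrite -tn_impP tnA.
apply: le_trans (bigvee_ub _ y).
by rewrite tn_le // tn_impK.
Qed.

Definition tcomp : thom X Z := THom tcomp_M1 tcomp_M2 tcomp_M3 tcomp_M4.

End Composition.

Lemma tcompA (X Y Z W : tset) (h : thom Z W) (g : thom Y Z) (f : thom X Y) :
  tcomp h (tcomp g f) = tcomp (tcomp h g) f.
Proof.
apply: thom_ext => x w; rewrite [LHS]tcomp_funE /= /tcomp_fun.
under eq_fun do rewrite bigvee_tn.
rewrite bigvee_exchange; congr bigvee; apply/funext => y.
rewrite -[X in _ = X ** _]/(tcomp_fun h g y w) tcomp_funE bigvee_tn.
by congr bigvee; apply/funext => z; rewrite tnAC.
Qed.

Lemma tcomp1m (X Y : tset) (f : thom X Y) : tcomp (tid Y) f = f.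
Proof.
apply: thom_ext => x y; apply/eqP; rewrite eq_le; apply/andP; split.
  rewrite /= tcomp_funE; apply: bigvee_le => y' /=.
  by rewrite tnC thom_M2r.
rewrite /= tcomp_funE; apply: le_trans (bigvee_ub _ y).
by rewrite /= tn_imppp tnp1.
Qed.

Lemma tcompm1 (X Y : tset) (f : thom X Y) : tcomp f (tid X) = f.
Proof.
apply: thom_ext => x y; apply/eqP; rewrite eq_le; apply/andP; split.
  by apply: bigvee_le => x' /=; rewrite thom_M2l.
by apply: le_trans (bigvee_ub _ x); rewrite /= tn_imppp tnp1.
Qed.

Definition tset_category : category := Category tcompA tcomp1m tcompm1.

End TSet.

(* Main.v *)
From Pilot Require Import Defs.
From mathcomp Require Import all_boot all_order all_algebra.
From mathcomp Require Import interval_inference.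
From mathcomp Require Import all_classical all_reals all_analysis.

(** Call alpha(x,x) the extent of x, and let P_p be the one-point set of
    extent p.  A morphism X ~> P_p forces every extent of X to be at most p,
    and for p = 1 it forces them to be idempotent.

    If every object is exponentiable, P_1 is.  Let A = {x, z} have extents 1
    and t, with alpha(x,z) = t, and let E = {x, x'} have extents 1, with
    alpha(x,x') = t; E sits in the pushout of two copies of A along z : P_t.
    Let Z = {a, b} have extents 1 and alpha(a,b) = t * t.  The constant maps
    A * P_1 ~> P_1 ~> Z at a and at b agree on P_t * P_1, since all extents
    there are idempotents e <= t, so that e <= t * t.  Their transposes glue to
    E ~> Z^(P_1), hence to a map E ~> Z sending x to a and x' to b, and
    t = alpha(x,x') <= alpha(a,b) = t * t.  So every t is idempotent, which
    makes * the minimum.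

    If * is the minimum, a [0,1]_*-set is an Omega-set over the Heyting algebra
    [0,1].  Products are pointwise, and Z^Y consists of the pairs (p, f) with
    f : P_p * Y ~> Z, two such pairs being equal to the largest degree to which
    p and q hold and f and g agree. *)

Import Pilot.Defs.
Import Order.TTheory.

Local Set Implicit Arguments.
Local Unset Strict Implicit.

Local Open Scope ring_scope.

(** * One-point sets and the elements of a set as morphisms *)

Section Points.
Variables (R : realType) (T : continuous_tnorm R).
Local Notation I := {i01 R}.

Definition pt (p : I) : tset T.
Proof.
refine (@TSet R T unit (fun _ _ => p) _ _ _) => // [_ _|_ _ _].
- by rewrite minxx.
- exact: tn_ler.
Defined.

Lemma elem_hom_M4 (X : tset T) (x : X) (u v : pt (teq x x)) :
  teq u v <= bigvee (fun y => T (teq x y) (tn_imp T (teq y y) (teq x y))).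
Proof. by apply: le_trans (bigvee_ub _ x); rewrite tn_imppp tnp1. Qed.

(** The element x as a morphism: composing with it evaluates at x ([comp_elemE]), so arrow-level
    equations can be turned into pointwise ones and back. *)
Definition elem_hom (X : tset T) (x : X) : thom (pt (teq x x)) X.
Proof.
refine (@THom R T (pt (teq x x)) X (fun _ y => teq x y)
  (fun _ => tset_S1 x) _ _ (@elem_hom_M4 X x)).
- by move=> u v y y'; rewrite /= tn_imppp tnp1; exact: (thom_M2r (tid X)).
- by move=> u y y'; exact: tid_M3.
Defined.

Lemma comp_elemE (X Y : tset T) (f : thom X Y) (x : X) u y :
  tcomp f (elem_hom x) u y = f x y.
Proof.
apply/eqP; rewrite eq_le; apply/andP; split.
  by apply: bigvee_le => x' /=; rewrite thom_M2l.
by apply: le_trans (bigvee_ub _ x); rewrite /= tn_imppp tnp1.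
Qed.

End Points.

(** * Sets with two points *)

Section PairSet.
Variables (R : realType) (T : continuous_tnorm R) (p q r : {i01 R}).
Hypotheses (rp : r <= p) (rq : r <= q).

Definition pair_eq (x y : bool) : {i01 R} :=
  if x == y then (if x then p else q) else r.

Lemma pair_S1 x y : pair_eq x y <= Num.min (pair_eq x x) (pair_eq y y).
Proof. by case: x y => -[]; rewrite /pair_eq/= ?minxx// le_min rp rq. Qed.

Lemma pair_S2 x y : pair_eq x y = pair_eq y x.
Proof. by case: x y => -[]. Qed.

(** Two of three booleans coincide. If y is one of the coinciding pair, a residuation law suffices;
    otherwise z = x, and S1 bounds the off-diagonal value by the extent of x. *)
Lemma pair_S3 x y z :
  T (pair_eq y z) (tn_imp T (pair_eq y y) (pair_eq x y)) <= pair_eq x z.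
Proof.
have [->|xy] := eqVneq x y; first exact: tn_ler.
have [<-|yz] := eqVneq y z; first exact: tn_impK.
have -> : z = x by case: x y z xy yz => -[] [].
apply: le_trans (tn_ler _ _ _) _.
by have := pair_S1 y z; rewrite le_min => /andP[_]; case: x y z xy yz => -[] [].
Qed.

Definition pair_set : tset T := TSet pair_S1 pair_S2 pair_S3.

End PairSet.

(** * Gluing two morphisms along a common point *)

Section Gluing.
Variables (R : realType) (T : continuous_tnorm R) (t : {i01 R}).

(* [A] and [E] of the header: [true] is x, and [false] is z resp. x'. *)
Definition arm : tset T := pair_set T (i01_le1 t) (lexx t).
Definition two_points : tset T := pair_set T (i01_le1 t) (i01_le1 t).

(** The extent of z equals alpha(x,z), both being t, so the residual in M2 is 1 and transport from z
    to x loses nothing. *)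
Lemma arm_le (W : tset T) (f : thom arm W) y : f false y <= f true y.
Proof.
by have := thom_M2l f false true y; rewrite /= /pair_eq /= tn_imppp tnp1.
Qed.

Definition glue_fun (W : tset T) (u v : thom arm W) (x : two_points) :
  W -> {i01 R} := if x then u true else v true.

Section Glue.
Variables (W : tset T) (u v : thom arm W).
Hypothesis uv : forall y, u false y = v false y.

(** Passing from x to x' goes through z: multiplying by 1 -> t brings [u true] below [u false],
    which is [v false], and [arm_le] leads back up to [v true]. *)
Lemma glue_cross y y' :
  T (T (tn_imp T (teq y y) (teq y y')) (u true y)) (tn_imp T 1%:i01 t)
    <= v true y'.
Proof.
rewrite -tnA.
apply: (@le_trans _ _ (T (tn_imp T (teq y y) (teq y y')) (v false y))).
  by rewrite tn_le // -uv; exact: (thom_M2l u true false).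
exact: le_trans (thom_M2r v _ _ _) (arm_le v y').
Qed.

(** M4 of [u] at z already has t on the left; both factors on its right grow when z is replaced by
    the far ends of the two arms. *)
Lemma glue_le_bigvee :
  t <= bigvee (fun y => T (v true y) (tn_imp T (teq y y) (u true y))).
Proof.
apply: le_trans (thom_M4 u false false) _; apply: bigvee_le => y.
apply: le_trans (bigvee_ub _ y).
rewrite {1}uv tn_le ?arm_le // -tn_impP.
exact: le_trans (tn_impK _ _ _) (arm_le u y).
Qed.

End Glue.

Definition glue (W : tset T) (u v : thom arm W)
  (uv : forall y, u false y = v false y) : thom two_points W.
Proof.
(* The mixed cases come in both orders, so the agreement at z is wanted in both directions. *)
pose vu y := esym (uv y).
refine (@THom R T two_points W (glue_fun u v) _ _ _ _).
- case=> y; [exact: (thom_M1 u true)|exact: (thom_M1 v true)].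
- case=> -[] y y' /=.
  + exact: (thom_M2 u true true).
  + exact: glue_cross.
  + exact: glue_cross.
  + exact: (thom_M2 v true true).
- case=> y y'; [exact: (thom_M3 u true)|exact: (thom_M3 v true)].
- case=> -[].
  + exact: (thom_M4 u true true).
  + exact: glue_le_bigvee.
  + exact: glue_le_bigvee.
  + exact: (thom_M4 v true true).
Defined.

End Gluing.

(** * Cartesian closedness forces every degree to be idempotent *)

Section NotExponentiable.
Variables (R : realType) (T : continuous_tnorm R).
Local Notation I := {i01 R}.
Local Notation C := (tset_category T).

Definition pt1 : tset T := pt T 1%:i01.

Definition to_pt1 (X : tset T) (X1 : forall x : X, teq x x = 1%:i01) :
  thom X pt1.
Proof.
refine (@THom R T X pt1 (fun _ _ => 1%:i01) _ _ _ _).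
- by move=> x u; rewrite X1 /= minxx.
- by move=> x x' u u'; exact: i01_le1.
- by move=> x u u'; exact: i01_le1.
- move=> x x'; apply: le_trans (i01_le1 _) _.
  by apply: le_trans (bigvee_ub _ tt); rewrite /= tn_imppp tnp1.
Defined.

(** The join in M4 has a single term, so alpha(x,x) <= f * (p -> f) <= f, while M1 gives f <=
    alpha(x,x). In particular a morphism into a one-point set is unique. *)
Lemma thom_pt (X : tset T) (p : I) (f : thom X (pt T p)) (x : X) u :
  f x u = teq x x /\ T (teq x x) (tn_imp T p (teq x x)) = teq x x.
Proof.
have le1 : teq x x <= T (f x u) (tn_imp T p (f x u)).
  by apply: le_trans (thom_M4 f x x) _; apply: bigvee_le => -[]; case: u.
have fE : f x u = teq x x.
  by apply/eqP; rewrite eq_le thom_lel (le_trans le1) // tn_ler.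
by rewrite fE in le1; split=> //; apply/eqP; rewrite eq_le tn_ler.
Qed.

Lemma thom_pt_le (X : tset T) (p : I) (f : thom X (pt T p)) (x : X) :
  teq x x <= p.
Proof. by have [<- _] := thom_pt f x tt; exact: thom_ler. Qed.

Lemma tn_imp1 (a : I) : tn_imp T 1%:i01 a = a.
Proof. by rewrite -[LHS](tn1p T) tn_div // i01_le1. Qed.

Lemma thom_pt1_idem (X : tset T) (f : thom X pt1) (x : X) :
  T (teq x x) (teq x x) = teq x x.
Proof.
by have [_] := thom_pt f x tt; rewrite tn_imp1.
Qed.

(** With e the extent of [d], the composite is e * g. As e is idempotent, e = e * (e * e) <= e * (t
    * t) <= e * g. The value does not depend on g, which is what makes two different constant maps
    agree. *)
Lemma comp_pt1_idem (t : I) (X Y : tset T) (f : thom X pt1)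
    (g : thom pt1 Y) (d : X) y :
  teq d d <= t -> T t t <= g tt y -> tcomp g f d y = teq d d.
Proof.
move=> dt tg; have fd u := (thom_pt f d u).1.
have dd := thom_pt1_idem f d.
rewrite /= tcomp_funE; apply/eqP; rewrite eq_le; apply/andP; split.
  by apply: bigvee_le => u; rewrite fd tn_ler.
apply: le_trans (bigvee_ub _ tt); rewrite fd /= tn_imp1.
by rewrite -{1}dd -{1}dd -tnA tn_le // (le_trans (tn_le T dt dt)).
Qed.

Lemma comp_pairing (P : finite_products C) (X Y Z W : C) (f : hom Z X)
  (g : hom Z Y) (h : hom W Z) :
  comp (pairing P f g) h = pairing P (comp f h) (comp g h).
Proof.
by rewrite [LHS](pairing_uniq P) !compA prj1_pairing prj2_pairing.
Qed.

Lemma cartesian_closed_idem (t : I) : cartesian_closed C -> T t t = t.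
Proof.
move=> [P /(_ (pt1 : C))[G [ad]]].
pose P1 : C := pt1; pose F := prd_functor P P1.
pose Z : C := pair_set T (i01_le1 (T t t)) (i01_le1 (T t t)).
pose A : C := arm T t; pose E : C := two_points T t.
pose Pt : C := pt T t.
pose ta : @hom C P1 Z := @elem_hom R T Z true.
pose tb : @hom C P1 Z := @elem_hom R T Z false.
pose i : @hom C Pt A := @elem_hom R T A false.
pose s : @hom C P1 A := @elem_hom R T A true.
pose e : @hom C P1 E := @elem_hom R T E true.
pose e' : @hom C P1 E := @elem_hom R T E false.
(* The transposes of the constant maps at a and at b; by [adF], restricting them along any g again
   gives transposes of constant maps. *)
pose u := adj ad (comp ta (prj2 P A P1)).
pose v := adj ad (comp tb (prj2 P A P1)).
have prj2F (X Y : C) (f : hom X Y) :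
    comp (prj2 P Y P1) (fmap F f) = prj2 P X P1.
  exact: prj2_pairing.
have adF (f : @hom C P1 Z) (X Y : C) (g : hom X Y) :
    comp (adj ad (comp f (prj2 P Y P1))) g = adj ad (comp f (prj2 P X P1)).
  by rewrite -adj_natl -compA prj2F.
(* The product [P] is arbitrary; its extents are controlled through the projections: [prj1] bounds
   them by t and [prj2] makes them idempotent. *)
have agree : comp ta (prj2 P Pt P1) = comp tb (prj2 P Pt P1).
  apply: thom_ext => d z.
  have dt : teq d d <= t := thom_pt_le (prj1 P Pt P1) d.
  have ga : T t t <= (ta : thom pt1 _) tt z.
    by case: z => /=; rewrite /pair_eq /= ?i01_le1.
  have gb : T t t <= (tb : thom pt1 _) tt z.
    by case: z {ga} => /=; rewrite /pair_eq /= ?i01_le1.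
  exact: (etrans (comp_pt1_idem (prj2 P Pt P1 : thom _ pt1) dt ga)
            (esym (comp_pt1_idem (prj2 P Pt P1 : thom _ pt1) dt gb))).
have uv : comp u i = comp v i by rewrite !adF agree.
have uv' y : (u : thom (arm T t) _) false y = (v : thom (arm T t) _) false y.
  rewrite -(@comp_elemE _ _ (arm T t) _ u false tt).
  rewrite -(@comp_elemE _ _ (arm T t) _ v false tt).
  exact: (congr1 (fun f : thom (pt T t) _ => f tt y) uv).
pose w : @hom C E _ := glue uv'.
have we : comp w e = comp u s.
  apply: thom_ext => x y.
  exact: etrans (@comp_elemE _ _ E _ w true x y)
    (esym (@comp_elemE _ _ A _ u true x y)).
have we' : comp w e' = comp v s.
  apply: thom_ext => x y.
  exact: etrans (@comp_elemE _ _ E _ w false x y)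
    (esym (@comp_elemE _ _ A _ v true x y)).
(* Untransposing the glued map: [h] is the constant a over x and the constant b over x', by
   injectivity of the transposition. *)
have [h hw] : exists h, adj ad h = w.
  by case: (adj_bij ad E Z) => g _ gK; exists (g w).
have inj (X : C) : injective (@adj _ _ _ _ ad X Z) by exact/bij_inj/adj_bij.
have he : comp h (fmap F e) = comp ta (prj2 P P1 P1).
  by apply: inj; rewrite adj_natl hw we adF.
have he' : comp h (fmap F e') = comp tb (prj2 P P1 P1).
  by apply: inj; rewrite adj_natl hw we' adF.
(* All extents of E are 1, so E maps to P_1 and [h] can be pulled back along E ~> E * P_1. *)
have E1 (x : E) : teq (x : two_points T t) x = 1%:i01 by case: x.
pose k : @hom C E Z := comp h (pairing P (idm E) (to_pt1 E1 : @hom C E P1)).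
have kE (x : @hom C P1 E) (z : @hom C P1 Z) :
  comp h (fmap F x) = comp z (prj2 P P1 P1) -> comp k x = z.
  move=> hx; rewrite -[z]compm1 -(prj2_pairing P (idm P1) (idm P1)).
  rewrite compA -hx /k -!compA; congr comp.
  rewrite -[fmap F x]/(prd_map P P1 x) /prd_map !comp_pairing -!compA.
  rewrite prj1_pairing prj2_pairing.
  (* What remains is an equality of two morphisms P_1 ~> P_1, and [thom_pt] determines the values of
     both. *)
  rewrite comp1m compm1; congr pairing; apply: thom_ext => a b.
  by rewrite (thom_pt _ _ _).1.
have kP1 (x z : @hom C P1 _) : comp k x = z ->
    tcomp (k : thom (two_points T t) _) x tt true = (z : thom P1 _) tt true.
  by move=> <-.
have := kP1 _ _ (kE _ _ he); rewrite comp_elemE => ktt.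
have := kP1 _ _ (kE _ _ he'); rewrite comp_elemE => kft.
(* Transport from x to x' at the value a: k(x,a) = 1 and k(x',a) = t * t, so M2 reads t <= t * t. *)
have := thom_M2l (k : thom (two_points T t) _) true false true.
rewrite ktt kft /= /pair_eq /= tn1p tn_imp1 => tt2.
by apply/eqP; rewrite eq_le tn_ler.
Qed.

End NotExponentiable.

(** * Right adjoints from universal arrows *)

Section UniversalArrows.
Variables (C D : category) (F : functor C D) (G : D -> C).
Variable ev : forall Z, hom (F (G Z)) Z.
Variable cur : forall X Z, hom (F X) Z -> hom X (G Z).
Hypothesis curK : forall X Z (h : hom (F X) Z),
  comp (ev Z) (fmap F (cur h)) = h.
Hypothesis evK : forall X Z (k : hom X (G Z)),
  cur (comp (ev Z) (fmap F k)) = k.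

Lemma cur_comp X X' Z (h : hom (F X) Z) (f : hom X' X) :
  comp (cur h) f = cur (comp h (fmap F f)).
Proof. by rewrite -[LHS]evK fmapM compA curK. Qed.

(** [curK] and [evK] make [cur] bijective; functoriality of G and both naturality laws reduce to
    [cur_comp]. *)
Lemma right_adjoint_of_universal : has_right_adjoint F.
Proof.
pose Gmap X Y (f : hom X Y) : hom (G X) (G Y) := cur (comp f (ev X)).
have Gmap1 X : Gmap X X (idm X) = idm (G X).
  by rewrite /Gmap comp1m -[X in cur X]compm1 -(fmap1 F) evK.
have GmapM X Y Z (g : hom Y Z) (f : hom X Y) :
    Gmap X Z (comp g f) = comp (Gmap Y Z g) (Gmap X Y f).
  by rewrite /Gmap cur_comp -!compA curK.
exists (Functor Gmap1 GmapM); split.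
refine (@Adjunction _ _ F (Functor Gmap1 GmapM) cur _ _ _).
- move=> X Z; exists (fun k => comp (ev Z) (fmap F k)) => [h|k].
    exact: curK.
  exact: evK.
- by move=> X X' Z f h; rewrite cur_comp.
- by move=> X Z Z' k h; rewrite /= /Gmap cur_comp -compA curK.
Qed.

End UniversalArrows.

(** * The internal logic of truth degrees for the minimum *)

Section MinTNorm.
Variables (R : realType) (T : continuous_tnorm R).
Local Notation I := {i01 R}.
Local Notation C := (tset_category T).
Hypothesis Tmin : forall p q : I, T p q = Num.min p q.
Implicit Types s a b c : I.

Lemma le_tn s a b : (s <= T a b) = (s <= a) && (s <= b).
Proof. by rewrite Tmin le_min. Qed.

Lemma le_tn_imp s a b : s <= b -> s <= tn_imp T a b.
Proof. by move=> sb; rewrite -tn_impP; apply: le_trans sb; exact: tn_lel. Qed.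

Lemma le_eq a b : (forall s, s <= a <-> s <= b) -> a = b.
Proof. by move=> ab; apply/eqP; rewrite eq_le; apply/andP; split; apply/ab. Qed.

(** Existential elimination, reading [s <= a] as truth of a at stage s. It is distributivity of
    meets over joins; the join need not be attained, so a witness j comes only with a smaller
    stage. *)
Lemma bigvee_elim (J : Type) (f : J -> I) s c : s <= bigvee f ->
  (forall j s', s' <= s -> s' <= f j -> s' <= c) -> s <= c.
Proof.
move=> sf H; apply: (@le_trans _ _ (T s (bigvee f))).
  by rewrite le_tn lexx.
rewrite tn_bigvee; apply: bigvee_le => j.
by apply: (H j); [exact: tn_ler|exact: tn_lel].
Qed.

Lemma bigvee_intro (J : Type) (f : J -> I) j s : s <= f j -> s <= bigvee f.
Proof. by move=> sj; exact: le_trans sj (bigvee_ub _ j). Qed.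

(** With [thom_single] and [thom_total], this presents a morphism as a functional relation at each
    stage; the residuals of M2 to M4 disappear. *)
Lemma thom_rel (X Y : tset T) (f : thom X Y) s x x' y y' :
  s <= f x y -> s <= teq x x' -> s <= teq y y' -> s <= f x' y'.
Proof.
move=> sf sx sy; apply: le_trans (thom_M2 f x x' y y').
by rewrite !le_tn sf !le_tn_imp // tset_S2.
Qed.

Lemma thom_single (X Y : tset T) (f : thom X Y) s x y y' :
  s <= f x y -> s <= f x y' -> s <= teq y y'.
Proof.
move=> sy sy'; apply: le_trans (thom_M3 f x y y').
by rewrite le_tn sy' le_tn_imp.
Qed.

Lemma thom_total (X Y : tset T) (f : thom X Y) x :
  teq x x <= bigvee (f x).
Proof.
apply: le_trans (thom_M4 f x x) _; apply: bigvee_le => y.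
exact: le_trans (tn_ler _ _ _) (bigvee_ub _ y).
Qed.

Lemma teq_trans (X : tset T) s (x y z : X) :
  s <= teq x y -> s <= teq y z -> s <= teq x z.
Proof.
move=> sxy syz; apply: (thom_rel (f := tid X) sxy) => //.
exact: le_trans sxy (teq_lel _ _).
Qed.

(** * Building sets and morphisms from relational data *)

Section MinTSet.
Variables (X : Type) (e : X -> X -> I).
Hypothesis e_sym : forall x y, e x y = e y x.
Hypothesis e_trans : forall s x y z, s <= e x y -> s <= e y z -> s <= e x z.

Lemma min_tset_S1 x y : e x y <= Num.min (e x x) (e y y).
Proof.
rewrite le_min; apply/andP; split.
  by apply: (e_trans (lexx _)); rewrite e_sym.
by rewrite [leLHS]e_sym; apply: (e_trans (lexx _)); rewrite e_sym.
Qed.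

Lemma min_tset_S3 x y z : T (e y z) (tn_imp T (e y y) (e x y)) <= e x z.
Proof.
have yz : e y z <= e y y by have := min_tset_S1 y z; rewrite le_min => /andP[].
apply: (@e_trans _ _ y); last exact: tn_ler.
by apply: le_trans (tn_impK T (e y y) _); rewrite tn_le.
Qed.

Definition min_tset : tset T := TSet min_tset_S1 e_sym min_tset_S3.

End MinTSet.

Section MinTHom.
Variables (X Y : tset T) (f : X -> Y -> I).
Hypothesis f_lel : forall x y, f x y <= teq x x.
Hypothesis f_ler : forall x y, f x y <= teq y y.
Hypothesis f_rel : forall s x x' y y',
  s <= f x y -> s <= teq x x' -> s <= teq y y' -> s <= f x' y'.
Hypothesis f_single : forall s x y y',
  s <= f x y -> s <= f x y' -> s <= teq y y'.
Hypothesis f_total : forall x, teq x x <= bigvee (f x).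

Lemma min_thom_M1 x y : f x y <= Num.min (teq x x) (teq y y).
Proof. by rewrite le_min f_lel f_ler. Qed.

Lemma min_thom_M2 x x' y y' :
  T (T (tn_imp T (teq y y) (teq y y')) (f x y)) (tn_imp T (teq x x) (teq x' x))
    <= f x' y'.
Proof.
rewrite tnC tnA; apply: (@f_rel _ x x' y y'); rewrite -?tnA.
- exact: le_trans (tn_lel _ _ _) (tn_lel _ _ _).
- rewrite [X in _ <= X]tset_S2 tnCA; apply: le_trans (tn_lel _ _ _) _.
  by apply: le_trans (tn_impK T (teq x x) _); rewrite tnC tn_le.
- apply: le_trans (tn_lel _ _ _) _.
  by apply: le_trans (tn_impK T (teq y y) _); rewrite tnC tn_le.
Qed.

Lemma min_thom_M3 x y y' : T (f x y') (tn_imp T (teq x x) (f x y)) <= teq y y'.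
Proof.
apply: (@f_single _ x); last exact: tn_ler.
by apply: le_trans (tn_impK T (teq x x) _); rewrite tn_le.
Qed.

Lemma min_thom_M4 x x' :
  teq x x' <= bigvee (fun y => T (f x' y) (tn_imp T (teq y y) (f x y))).
Proof.
apply: bigvee_elim (le_trans (teq_lel x x') (f_total x)) _ => y s sx sf.
apply: (bigvee_intro (j := y)); rewrite le_tn le_tn_imp // andbT.
by apply: (f_rel sf) => //; exact: le_trans (f_ler x y).
Qed.

Definition min_thom : thom X Y :=
  THom min_thom_M1 min_thom_M2 min_thom_M3 min_thom_M4.

End MinTHom.

Lemma tcomp_intro (X Y Z : tset T) (g : thom Y Z) (f : thom X Y) s x y z :
  s <= g y z -> s <= f x y -> s <= tcomp g f x z.
Proof.
move=> sg sf; apply: (bigvee_intro (j := y)).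
by rewrite le_tn sg le_tn_imp.
Qed.

Lemma tcomp_elim (X Y Z : tset T) (g : thom Y Z) (f : thom X Y) s c x z :
  s <= tcomp g f x z ->
  (forall y s', s' <= s -> s' <= g y z -> s' <= f x y -> s' <= c) -> s <= c.
Proof.
move=> sfg H; apply: bigvee_elim sfg _ => y s' ss' s'gf; apply: (H y) => //.
  exact: le_trans s'gf (tn_ler _ _ _).
apply: le_trans s'gf _; apply: le_trans (tn_impK T (teq y y) _).
by rewrite tn_le // thom_lel.
Qed.

Lemma le_minP s a b : s <= Num.min a b <-> s <= a /\ s <= b.
Proof. by rewrite le_min; split=> [/andP|[-> ->]]. Qed.

(** * Finite products for the minimum *)

Section Product.
Variables X Y : tset T.

Definition prod_eq (u v : X * Y) : I := Num.min (teq u.1 v.1) (teq u.2 v.2).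

Lemma prod_eq_sym u v : prod_eq u v = prod_eq v u.
Proof. by rewrite /prod_eq tset_S2 (tset_S2 u.2). Qed.

Lemma prod_eq_trans s u v w :
  s <= prod_eq u v -> s <= prod_eq v w -> s <= prod_eq u w.
Proof.
move=> /le_minP[u1 u2] /le_minP[w1 w2]; apply/le_minP.
by split; [apply: teq_trans w1|apply: teq_trans w2].
Qed.

Definition prod_tset : tset T := min_tset prod_eq_sym prod_eq_trans.

(** The second factor of the meet caps the value at the extent of the pair, as M1 demands. *)
Definition proj1_thom : thom prod_tset X.
Proof.
refine (@min_thom prod_tset X (fun u x => Num.min (teq u.1 x) (teq u.2 u.2))
  _ _ _ _ _).
- by move=> [x y] x'; apply/le_minP; split; rewrite ge_min ?teq_lel ?lexx ?orbT.
- by move=> [x y] x'; rewrite ge_min teq_ler.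
- move=> s [x y] [x' y'] z z' /le_minP[/= xz yy] /le_minP[/= xx' yy'] zz'.
  apply/le_minP; split; last exact: le_trans yy' (teq_ler _ _).
  by apply: teq_trans zz'; apply: teq_trans xz; rewrite tset_S2.
- move=> s [x y] z z' /le_minP[/= xz _] /le_minP[/= xz' _].
  by apply: teq_trans xz'; rewrite tset_S2.
- by move=> [x y]; apply: (bigvee_intro (j := x)).
Defined.

Definition proj2_thom : thom prod_tset Y.
Proof.
refine (@min_thom prod_tset Y (fun u y => Num.min (teq u.1 u.1) (teq u.2 y))
  _ _ _ _ _).
- by move=> [x y] y'; apply/le_minP; split; rewrite ge_min ?teq_lel ?lexx ?orbT.
- by move=> [x y] y'; rewrite ge_min teq_ler orbT.
- move=> s [x y] [x' y'] z z' /le_minP[/= xx yz] /le_minP[/= xx' yy'] zz'.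
  apply/le_minP; split; first exact: le_trans xx' (teq_ler _ _).
  by apply: teq_trans zz'; apply: teq_trans yz; rewrite tset_S2.
- move=> s [x y] z z' /le_minP[/= _ yz] /le_minP[/= _ yz'].
  by apply: teq_trans yz'; rewrite tset_S2.
- by move=> [x y]; apply: (bigvee_intro (j := y)).
Defined.

Definition pair_thom (Z : tset T) (f : thom Z X) (g : thom Z Y) :
  thom Z prod_tset.
Proof.
refine (@min_thom Z prod_tset (fun z u => Num.min (f z u.1) (g z u.2))
  _ _ _ _ _).
- by move=> z [x y]; rewrite ge_min thom_lel.
- by move=> z [x y]; apply/le_minP; split; rewrite ge_min thom_ler ?orbT.
- move=> s z z' [x y] [x' y'] /le_minP[/= fx gy] zz' /le_minP[/= xx' yy'].
  by apply/le_minP; split; [exact: thom_rel fx _ _|exact: thom_rel gy _ _].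
- move=> s z [x y] [x' y'] /le_minP[/= fx gy] /le_minP[/= fx' gy'].
  by apply/le_minP; split; [exact: thom_single fx _|exact: thom_single gy _].
- move=> z; apply: bigvee_elim (thom_total f z) _ => x s sz sx.
  apply: bigvee_elim (le_trans sz (thom_total g z)) _ => y s' ss' s'y.
  by apply: (bigvee_intro (j := (x, y))); rewrite le_min (le_trans ss' sx).
Defined.

Lemma proj1_pair (Z : tset T) (f : thom Z X) (g : thom Z Y) :
  tcomp proj1_thom (pair_thom f g) = f.
Proof.
apply: thom_ext => z x; apply: le_eq => s; split=> [|sx].
  move=> /tcomp_elim; apply => -[x' y'] s' ss'.
  move=> /le_minP[/= xx' _] /le_minP[/= fx' _].
  by apply: (thom_rel fx') => //; exact: le_trans fx' (thom_lel _ _ _).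
have sz := le_trans sx (thom_lel f z x).
apply: bigvee_elim (le_trans sz (thom_total g z)) _ => y s' ss' gy.
apply: (tcomp_intro (y := (x, y) : prod_tset)); apply/le_minP; split=> //=.
- exact: le_trans ss' (le_trans sx (thom_ler _ _ _)).
- exact: le_trans gy (thom_ler _ _ _).
- exact: le_trans ss' sx.
Qed.

Lemma proj2_pair (Z : tset T) (f : thom Z X) (g : thom Z Y) :
  tcomp proj2_thom (pair_thom f g) = g.
Proof.
apply: thom_ext => z y; apply: le_eq => s; split=> [|sy].
  move=> /tcomp_elim; apply => -[x' y'] s' ss'.
  move=> /le_minP[/= _ yy'] /le_minP[/= _ gy'].
  by apply: (thom_rel gy') => //; exact: le_trans gy' (thom_lel _ _ _).
have sz := le_trans sy (thom_lel g z y).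
apply: bigvee_elim (le_trans sz (thom_total f z)) _ => x s' ss' fx.
apply: (tcomp_intro (y := (x, y) : prod_tset)); apply/le_minP; split=> //=.
- exact: le_trans fx (thom_ler _ _ _).
- exact: le_trans ss' (le_trans sy (thom_ler _ _ _)).
- exact: le_trans ss' sy.
Qed.

Lemma pair_thom_uniq (Z : tset T) (h : thom Z prod_tset) :
  h = pair_thom (tcomp proj1_thom h) (tcomp proj2_thom h).
Proof.
apply: thom_ext => z u; apply: le_eq => s; split=> [sh|/le_minP[s1 s2]].
  have /le_minP[su1 su2] := le_trans sh (thom_ler h z u).
  by apply/le_minP; split; apply: (tcomp_intro (y := u)) => //;
    apply/le_minP; split.
(* The two components supply different witnesses [v] and [w] for the value of h at z;
   single-valuedness identifies them, so [w] also matches [u] in the first component. *)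
apply: tcomp_elim s1 _ => v s' ss' /le_minP[vu1 _] hv.
apply: tcomp_elim (le_trans ss' s2) _ => w t ts' /le_minP[_ wu2] hw.
have /le_minP[_ vw] := thom_single (le_trans ts' hv) hw.
apply: (thom_rel hw); first exact: le_trans hw (thom_lel _ _ _).
apply/le_minP; split=> //.
have /le_minP[wv _] := thom_single hw (le_trans ts' hv).
exact: teq_trans wv (le_trans ts' vu1).
Qed.

End Product.

Definition bang_thom (X : tset T) : thom X (pt T 1%:i01).
Proof.
refine (@min_thom X (pt T 1%:i01) (fun x _ => teq x x) _ _ _ _ _) => //.
- by move=> x u; exact: i01_le1.
- by move=> s x x' u u' _ sx _; exact: le_trans sx (teq_ler _ _).
- by move=> s x u u' _ _; exact: i01_le1.
- by move=> x; exact: (bigvee_ub (fun=> teq x x) tt).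
Defined.

Lemma bang_thom_uniq (X : tset T) (f : thom X (pt T 1%:i01)) : f = bang_thom X.
Proof. by apply: thom_ext => x u; exact: (thom_pt f x u).1. Qed.

Definition tset_products : finite_products C :=
  @FiniteProducts C (pt T 1%:i01) bang_thom bang_thom_uniq prod_tset
    proj1_thom proj2_thom pair_thom proj1_pair proj2_pair pair_thom_uniq.

Lemma le_prd_map (X X' Y : tset T) (k : thom X X')
    s (x : X) (x' : X') (y y' : Y) :
  s <= (prd_map tset_products Y (k : @hom C X X')
          : thom (prod_tset X Y) (prod_tset X' Y)) (x, y) (x', y') <->
  s <= k x x' /\ s <= teq y y'.
Proof.
split=> [/le_minP[/= s1 /le_minP[/= _ s2]]|[sk sy]].
  split=> //; apply: tcomp_elim s1 _ => a s' ss' ka /le_minP[/= xa _].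
  apply: (thom_rel ka); last exact: le_trans ka (thom_ler _ _ _).
  by rewrite tset_S2.
have sx := le_trans sk (thom_lel k x x').
apply/le_minP; split; last exact/le_minP.
apply: (tcomp_intro (y := x)) => //; apply/le_minP; split=> //.
exact: le_trans sy (teq_lel _ _).
Qed.

(** * Exponentials for the minimum *)

Section Exponential.
Variables Y Z : tset T.

(* A morphism out of P_p * Y is a morphism out of Y cut down to extents <= p. *)
Definition partial_hom : Type := {p : I & thom (prod_tset (pt T p) Y) Z}.

Definition value (F : partial_hom) (y : Y) (z : Z) : I := projT2 F (tt, y) z.

(** Multiplying by s, instead of quantifying over smaller stages, turns each clause into an upper
    bound on s by residuation. Hence the supremum in [expo_eq] is attained ([expo_eqP]). *)
Definition agree s (F G : partial_hom) : Prop :=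
  [/\ s <= projT1 F, s <= projT1 G & forall y z,
    T (value F y z) s <= value G y z /\ T (value G y z) s <= value F y z].

Definition expo_eq (F G : partial_hom) : I :=
  supremum 0%:i01 [set s | agree s F G]%classic.

Lemma expo_eqP s F G : s <= expo_eq F G <-> agree s F G.
Proof.
split=> [sFG|]; last exact: i01_sup_ub.
suff [FG1 FG2 FG3] : agree (expo_eq F G) F G.
  split; try by apply: le_trans sFG _.
  by move=> y z; have [FG GF] := FG3 y z; split;
    [apply: le_trans FG|apply: le_trans GF]; rewrite tn_le.
split; try by apply: i01_sup_le => r [].
by move=> y z; split; rewrite tn_impP; apply: i01_sup_le => r [_ _ /(_ y z)[]];
  rewrite !tn_impP.
Qed.

Lemma expo_le s F G y z :
  s <= expo_eq F G -> s <= value F y z -> s <= value G y z.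
Proof.
move=> /expo_eqP[_ _ /(_ y z)[FG _]] sF.
by apply: le_trans FG; rewrite le_tn sF lexx.
Qed.

Lemma expo_eq_sym F G : expo_eq F G = expo_eq G F.
Proof.
by apply: le_eq => s; split=> /expo_eqP[? ? FG]; apply/expo_eqP; split=> // y z;
  have [] := FG y z.
Qed.

Lemma expo_eq_intro s F G : s <= projT1 F -> s <= projT1 G ->
  (forall y z s', s' <= s -> s' <= value F y z <-> s' <= value G y z) ->
  s <= expo_eq F G.
Proof.
move=> sF sG FG; apply/expo_eqP; split=> // y z.
by split; apply/(FG y z); rewrite ?tn_lel ?tn_ler.
Qed.

Lemma expo_eq_trans s F G H :
  s <= expo_eq F G -> s <= expo_eq G H -> s <= expo_eq F H.
Proof.
move=> FG GH; have [sF _ _] := (expo_eqP _ _ _).1 FG.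
have [_ sH _] := (expo_eqP _ _ _).1 GH.
apply: expo_eq_intro => // y z s' ss'; split=> [sFy|sHy].
  exact: expo_le (le_trans ss' GH) (expo_le (le_trans ss' FG) sFy).
rewrite expo_eq_sym in FG; rewrite expo_eq_sym in GH.
exact: expo_le (le_trans ss' FG) (expo_le (le_trans ss' GH) sHy).
Qed.

Definition expo : tset T := min_tset expo_eq_sym expo_eq_trans.

Lemma expo_extent F : expo_eq F F = projT1 F.
Proof.
apply: le_eq => s; split=> [/expo_eqP[]//|sF]; exact: expo_eq_intro.
Qed.

Definition eval_thom : thom (prod_tset expo Y) Z.
Proof.
refine (@min_thom (prod_tset expo Y) Z (fun u z => value u.1 u.2 z) _ _ _ _ _).
- move=> [F y] z; apply: le_trans (thom_lel (projT2 F) (tt, y) z) _.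
  by apply/le_minP; rewrite /= expo_extent; apply/le_minP.
- by move=> [F y] z; exact: thom_ler.
- move=> s [F y] [G y'] z z' /= sF /le_minP[/= FG yy'] zz'.
  apply: (thom_rel (expo_le FG sF)) zz'; apply/le_minP; split=> //=.
  by have /expo_eqP[] := FG.
- by move=> s [F y] z z'; exact: thom_single.
- move=> [F y]; apply: le_trans (thom_total (projT2 F) (tt, y)).
  by apply/le_minP; rewrite /= -expo_extent; apply/le_minP.
Defined.

Section Curry.
Variables (X : tset T) (h : thom (prod_tset X Y) Z).

Definition slice_thom (x : X) : thom (prod_tset (pt T (teq x x)) Y) Z.
Proof.
refine (@min_thom (prod_tset (pt T (teq x x)) Y) Z (fun u z => h (x, u.2) z)
  _ _ _ _ _).
- by move=> u z; exact: (thom_lel h (x, u.2) z).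
- by move=> u z; exact: thom_ler.
- move=> s u v z z' sh uv zz'.
  exact: (@thom_rel _ _ h _ (x, u.2) (x, v.2)) sh uv zz'.
- by move=> s u z z'; exact: thom_single.
- by move=> u; exact: (thom_total h (x, u.2)).
Defined.

Definition slice (x : X) : expo := existT _ (teq x x) (slice_thom x).

Lemma slice_rel s x x' : s <= teq x x' -> s <= teq (slice x) (slice x').
Proof.
move=> xx'; have sx := le_trans xx' (teq_lel _ _).
have sx' := le_trans xx' (teq_ler _ _).
apply: expo_eq_intro => // y z s' ss'.
have hrel (a b : X) : s <= teq a b -> s' <= h (a, y) z -> s' <= h (b, y) z.
  move=> ab sh; apply: (thom_rel sh); last exact: le_trans sh (thom_ler _ _ _).
  apply/le_minP; split; first exact: le_trans ss' ab.
  by have /le_minP[] := le_trans sh (thom_lel h _ _).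
by split; apply: hrel; rewrite // tset_S2.
Qed.

(** The functional relation induced by x |-> [slice x], closed under the equality of [expo]. *)
Definition curry_thom : thom X expo.
Proof.
refine (@min_thom X expo (fun x F => teq (slice x) F) _ _ _ _ _).
- by move=> x F; apply: le_trans (teq_lel _ _) _; rewrite /= expo_extent.
- by move=> x F; exact: teq_ler.
- move=> s x x' F F' sF xx' FF'; apply: teq_trans FF'.
  by apply: teq_trans sF; rewrite tset_S2 slice_rel.
- by move=> s x F F' sF sF'; apply: teq_trans sF'; rewrite tset_S2.
- move=> x; apply: (bigvee_intro (j := slice x)).
  exact: slice_rel.
Defined.

End Curry.

Lemma eval_curry (X : tset T) (h : thom (prod_tset X Y) Z) :
  comp (eval_thom : @hom C _ _)
    (prd_map tset_products Y (curry_thom h : @hom C X expo)) = h.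
Proof.
apply: thom_ext => -[x y] z; apply: le_eq => s; split=> [|sh].
  move=> /tcomp_elim; apply => -[F y'] s' ss' /= sF /le_prd_map[xF yy'].
  rewrite /= expo_eq_sym in xF; have {}sF : s' <= h (x, y') z := expo_le xF sF.
  apply: (thom_rel sF); last exact: le_trans sF (thom_ler _ _ _).
  have /le_minP[sx _] := le_trans sF (thom_lel h _ _).
  by apply/le_minP; rewrite /= tset_S2.
apply: (tcomp_intro (y := (slice h x, y) : prod_tset expo Y)) => //.
have /le_minP[/= sx sy] := le_trans sh (thom_lel h _ _).
by apply/le_prd_map; split=> //; exact: slice_rel.
Qed.

Lemma curry_eval (X : tset T) (k : thom X expo) :
  curry_thom (comp (eval_thom : @hom C _ _)
    (prd_map tset_products Y (k : @hom C X expo))) = k.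
Proof.
set h := comp _ _.
(* Wherever k relates x to F, the slice of h at x and F have the same values, so they are equal in
   [expo] to that degree. *)
have hk s x F y z : s <= k x F ->
    s <= (h : thom (prod_tset X Y) Z) (x, y) z <-> s <= value F y z.
  move=> sk; split=> [|sF].
    move=> /tcomp_elim; apply => -[G y'] s' ss' /= sG /le_prd_map[kG yy'].
    have sF := expo_le (thom_single kG (le_trans ss' sk)) sG.
    apply: (thom_rel sF); last exact: le_trans sF (thom_ler _ _ _).
    have /le_minP[sp _] := le_trans sF (thom_lel _ _ _).
    by apply/le_minP; rewrite /= tset_S2.
  apply: (tcomp_intro (y := (F, y) : prod_tset expo Y)) => //.
  apply/le_prd_map; split=> //.
  by have /le_minP[] := le_trans sF (thom_lel _ _ _).
have kslice s x F : s <= k x F -> s <= teq (slice h x) F.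
  move=> sk; apply: expo_eq_intro.
  - exact: le_trans sk (thom_lel _ _ _).
  - by rewrite -expo_extent; exact: le_trans sk (thom_ler _ _ _).
  - by move=> y z s' ss'; apply: hk; exact: le_trans ss' sk.
apply: thom_ext => x F; apply: le_eq => s; split=> [sF|]; last exact: kslice.
have sx : s <= teq x x by have /expo_eqP[] := sF.
(* Totality of k yields some G related to x; G equals the slice at x by [kslice], hence equals F. *)
apply: bigvee_elim (le_trans sx (thom_total k x)) _ => G s' ss' kG.
apply: (thom_rel kG); first exact: le_trans ss' sx.
by apply: teq_trans (le_trans ss' sF); rewrite tset_S2 kslice.
Qed.

End Exponential.

Lemma min_cartesian_closed : cartesian_closed C.
Proof.
exists tset_products => Y.
refine (@right_adjoint_of_universal C C (prd_functor tset_products Y)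
  (expo Y) (eval_thom Y)
  (fun X Z => @curry_thom Y Z X) (fun X Z => @eval_curry Y Z X)
  (fun X Z => @curry_eval Y Z X)).
Qed.

End MinTNorm.

Local Unset Implicit Arguments.

Theorem theorem4p6 (R : realType) (T : continuous_tnorm R) :
  cartesian_closed (tset_category T) <->
  (forall p q : {i01 R}, T p q = Num.min p q).
Proof.
split=> [cc p q|]; last exact: min_cartesian_closed.
apply/eqP; rewrite eq_le le_min tn_ler tn_lel /=.
(* Idempotency of the meet m of p and q gives m = m * m <= p * q. *)
rewrite -[leLHS](cartesian_closed_idem _ cc).
by rewrite tn_le // ge_min lexx ?orbT.
Qed.
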